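(* Let $s\in\mathbb{N}$ with $s\ge 3$, let $N\in\mathbb{N}$ with $N\ge s$, and let $R(s,N)=\{r(S): S\subseteq[1,N],\ |S|=s\}$, with smallest element $f_{s,N}$ and largest element $g_{s,N}$. Then: (i) for $N=s$ and $N=s+1$, $$R(s,N)=[f_{s,N},g_{s,N}]=\left[\tfrac{(2s-N)(2s-N-1)}{2},\tfrac{s(s-1)}{2}\right],$$ where $f_{s,N}>0$; (ii) for $s+2\le N\le 2s-2$, $$R(s,N)=[f_{s,N},g_{s,N}]\setminus E,$$ where $f_{s,N}=\frac{(2s-N)(2s-N-1)}{2}>0$, $g_{s,N}=\frac{s(s-1)}{2}$, and $E=\{x_1,\ldots,x_e\}$ is a set satisfying $$\{f_{s,N}+1\}\subseteq E\subseteq\left\{f_{s,N}+(2i-1): 1\le i\le \min\left(s-\left\lceil \tfrac N2\right\rceil,\left\lfloor\tfrac{N-s}{2}\right\rfloor\right)\right\};$$ (iii) for $N\ge 2s-1$, $$R(s,N)=[f_{s,N},g_{s,N}]=\left[0,\tfrac{s(s-1)}{2}\right].$$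
   Context: $\mathbb{N}$ denotes the positive integers. For integers $a\le b$, $[a,b]$ denotes the set of integers $x$ with $a\le x\le b$. For a finite set $S\subseteq\mathbb{N}$, $r(S)=|\{(x,y)\in S^2: x+y\in S\}|$ (ordered pairs, $x=y$ allowed). *)

(* Defs.v *)
From mathcomp Require Import all_boot finmap.

Set Implicit Arguments.
Unset Strict Implicit.
Unset Printing Implicit Defensive.

Local Open Scope fset_scope.
Local Open Scope nat_scope.

(* [a, b], both endpoints included; empty if b < a. *)
Definition itv (a b : nat) : {fset nat} := [fset x in iota a (b.+1 - a)].

Definition r (S : {fset nat}) : nat :=
  #|` [fset p in S `*` S | p.1 + p.2 \in S]|.

Definition R (s N : nat) : {fset nat} :=
  [fset r S | S in fpowerset (itv 1 N) & #|` S| == s].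

Definition gmax (s N : nat) : nat := \max_(x <- R s N) x.

(* minn has no neutral element on nat, so the iterated minimum is seeded with
   the largest element; fmin_in and fmin_le below characterize it. *)
Definition fmin (s N : nat) : nat := \big[minn/gmax s N]_(x <- R s N) x.

Lemma in_itv (a b x : nat) : (x \in itv a b) = (a <= x <= b).
Proof.
rewrite !inE /= mem_iota; case: (leqP a x) => //= ax.
case: (leqP a b.+1) => ab; first by rewrite subnKC.
have /eqP-> : b.+1 - a == 0 by rewrite subn_eq0 ltnW.
rewrite addn0 ltnNge ax; apply/esym/negbTE; rewrite -ltnNge.
by apply: leq_trans ax; apply: ltnW.
Qed.

Lemma R_P (s N n : nat) :
  reflect (exists S : {fset nat}, [/\ S `<=` itv 1 N, #|` S| = s & r S = n])
          (n \in R s N).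
Proof.
apply: (iffP idP) => [/imfsetP[S /= + ->]|[S [SN Ss <-]]].
  by rewrite !inE fpowersetE => /andP[SN /eqP Ss]; exists S.
by apply/imfsetP; exists S => //=; rewrite !inE fpowersetE SN Ss eqxx.
Qed.

Lemma R_neq0 (s N : nat) : s <= N -> R s N != fset0.
Proof.
move=> sN; apply/fset0Pn; exists (r (itv 1 s)); apply/R_P; exists (itv 1 s).
split=> //.
  by apply/fsubsetP => x; rewrite !in_itv => /andP[-> /leq_trans ->].
by rewrite card_fseq undup_id ?iota_uniq// size_iota subn1.
Qed.

Lemma gmax_ge (s N x : nat) : x \in R s N -> x <= gmax s N.
Proof. by move=> xR; apply: leq_bigmax_seq. Qed.

Lemma gmax_in (s N : nat) : s <= N -> gmax s N \in R s N.
Proof.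
move=> /R_neq0 /fset0Pn[y yR]; rewrite /gmax.
have H (t : seq nat) : t != [::] -> \max_(x <- t) x \in t.
  elim: t => [//|x [|z t] IH] _; first by rewrite big_seq1 mem_seq1.
  rewrite big_cons /maxn inE; case: ifP => _; last by rewrite eqxx.
  by rewrite IH ?orbT.
apply: H; apply/eqP => R0.
by have : y \in enum_fset (R s N) by []; rewrite R0.
Qed.

Lemma fmin_le (s N x : nat) : x \in R s N -> fmin s N <= x.
Proof.
rewrite /fmin; move: (gmax s N) => c.
have : forall t : seq nat, x \in t -> \big[minn/c]_(y <- t) y <= x.
  elim=> [//|z t IH]; rewrite inE big_cons geq_min.
  by case/predU1P => [->|/IH ->]; rewrite ?leqnn ?orbT.
exact.
Qed.

Lemma fmin_in (s N : nat) : s <= N -> fmin s N \in R s N.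
Proof.
move=> /gmax_in gR; rewrite /fmin big_seq.
apply: (big_ind (fun x => x \in R s N)) => // x y xR yR.
by rewrite /minn; case: ifP.
Qed.

(* Main.v *)
(* Write d(z) and e(z) for the number of x < z with x, z - x both in S,
   respectively both outside S; then d(z) + (z - 1) = 2 |S below z| + e(z).
   Adding the elements of S in increasing order, d(z) <= |S below z| gives the
   upper bound and d(z) >= 2 |S below z| - (z - 1) the lower one.  If
   r(S) = f + 1, with D = N - s, nearly all these inequalities are equalities:
   S contains [2D + 2, N], and the scarcity of pairs outside S with sum 2D,
   2D + 1 or 2D + 2 propagates membership along the small elements until a
   contradiction.  Conversely, for t = s - b all values between C(t, 2) and
   C(t + 1, 2), except some odd offsets from C(t, 2), are realised in
   [1, b + s] by the intervals [b, b + s] with one point deleted and by the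
   sets {c} U [b + 2, b + s]; the missing ones appear in [1, b + s + 1]. *)

Require Import Defs.
From mathcomp Require Import all_boot finmap zify.

Local Open Scope fset_scope.
Local Open Scope nat_scope.

(** * Counting sums through membership predicates *)

(* Only the values of [P] at positive integers matter, and the bound [z] is
   excluded in all three sums: r(S) for S in [1, N] is [schur P N.+1]. *)
Definition below (P : pred nat) (z : nat) : nat := \sum_(1 <= x < z) P x.

Definition reps (P : pred nat) (z : nat) : nat :=
  \sum_(1 <= x < z) (P x && P (z - x)).

Definition schur (P : pred nat) (z : nat) : nat :=
  \sum_(1 <= y < z) P y * reps P y.

Lemma belowS (P : pred nat) (z : nat) :
  0 < z -> below P z.+1 = below P z + P z.
Proof. by move=> z0; rewrite /below big_nat_recr. Qed.

Lemma schurS (P : pred nat) (z : nat) :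
  schur P z.+1 = schur P z + P z * reps P z.
Proof.
case: z => [|z]; last by rewrite /schur big_nat_recr.
by rewrite /schur /reps !big_geq ?muln0.
Qed.

Lemma size_filter_iota (P : pred nat) (z : nat) :
  size [seq x <- iota 1 z.-1 | P x] = \sum_(1 <= x < z) P x.
Proof.
rewrite size_filter -sum1_count big_mkcond /= /index_iota subn1.
by apply: eq_bigr => x _; case: (P x).
Qed.

(** Grouping the pairs (x, y) by their sum z writes each as (x, z - x); [B] lists them in that
    form. *)
Lemma r_schur (S : {fset nat}) (N : nat) :
  S `<=` itv 1 N -> r S = schur (fun x => x \in S) N.+1.
Proof.
move=> /fsubsetP SN.
pose t z := [seq x <- iota 1 z.-1 | (x \in S) && (z - x \in S)].
pose B := [seq (x, z - x) | z <- [seq x <- iota 1 N | x \in S], x <- t z].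
have uB : uniq B.
  apply: allpairs_uniq_dep => [|z _|[z x] [z' x'] /=]; rewrite ?filter_uniq ?iota_uniq //.
  move=> /allpairsPdep[u [v [_ + E]]] /allpairsPdep[u' [v' [_ + E']]].
  case: E E' => -> -> [-> ->]; rewrite !mem_filter !mem_iota.
  move=> /andP[_ h1] /andP[_ h2] /= [h3 h4]; subst v'.
  by have -> : u = u' by lia.
rewrite /r (@perm_size _ _ B); last first.
  apply: uniq_perm; rewrite ?fset_uniq // => -[x y]; rewrite !inE /=; apply/idP/allpairsPdep.
    move=> /andP[/andP[xS yS] xyS]; exists (x + y), x.
    have := SN _ xS; have := SN _ yS; have := SN _ xyS; rewrite !in_itv => *.
    by rewrite !mem_filter !mem_iota xS xyS addKn yS; split => //; lia.
  move=> [z [x' [+ + [-> ->]]]]; rewrite !mem_filter !mem_iota => /andP[zS _].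
  by move=> /andP[/andP[xS zxS] h]; rewrite xS zxS subnKC //; lia.
rewrite size_allpairs_dep sumnE big_map big_filter big_mkcond /= /schur /index_iota subn1.
apply: eq_bigr => z _; rewrite size_filter_iota /reps.
by case: (z \in S); rewrite ?mul1n ?mul0n.
Qed.

Lemma card_below (S : {fset nat}) (N : nat) :
  S `<=` itv 1 N -> #|` S| = below (fun x => x \in S) N.+1.
Proof.
move=> /fsubsetP SN; rewrite /below -size_filter_iota.
apply: perm_size; apply: uniq_perm; rewrite ?fset_uniq ?filter_uniq ?iota_uniq // => x.
rewrite mem_filter mem_iota /=; case xS: (x \in S) => //=.
by have := SN _ xS; rewrite in_itv; lia.
Qed.

Lemma eq_below (P Q : pred nat) (z : nat) :
  (forall x, 0 < x < z -> P x = Q x) -> below P z = below Q z.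
Proof. by move=> PQ; apply: eq_big_nat => x xz; rewrite PQ. Qed.

Lemma eq_schur (P Q : pred nat) (z : nat) :
  (forall x, 0 < x < z -> P x = Q x) -> schur P z = schur Q z.
Proof.
move=> PQ; apply: eq_big_nat => y yz; rewrite PQ //; congr (_ * _).
by apply: eq_big_nat => x xy; rewrite !PQ //; lia.
Qed.

(** Witnesses may be arbitrary predicates, since both counts look only at [1, N]. *)
Lemma R_schurP (s N n : nat) :
  n \in R s N <-> exists P, below P N.+1 = s /\ schur P N.+1 = n.
Proof.
split=> [/R_P[S [SN <- <-]]|[P [<- <-]]].
  by exists (fun x => x \in S); rewrite -card_below // -r_schur.
pose S := [fset x in itv 1 N | P x].
have SN : S `<=` itv 1 N by apply/fsubsetP => x; rewrite !inE => /andP[].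
have SP x : 0 < x < N.+1 -> (x \in S) = P x.
  by move=> xN; rewrite !inE /= mem_iota; case: (P x); lia.
by apply/R_P; exists S; rewrite (card_below _ _ SN) (r_schur _ _ SN)
  (eq_below _ _ _ SP) (eq_schur _ _ _ SP).
Qed.

Lemma R_mono (s K N n : nat) : K <= N -> n \in R s K -> n \in R s N.
Proof.
move=> KN /R_P[S [/fsubsetP SK Ss Sn]]; apply/R_P; exists S; split=> //.
by apply/fsubsetP => x /SK; rewrite !in_itv; lia.
Qed.

(** * Complement counting and the two binomial bounds *)

Definition corep (P : pred nat) (z : nat) : nat := reps (predC P) z.

(** For each x, [both in] + 1 = [x in] + [z - x in] + [neither in]; reflecting x to z - x shows that
    the two middle terms have equal sums. *)
Lemma reps_corep (P : pred nat) (z : nat) :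
  reps P z + z.-1 = 2 * below P z + corep P z.
Proof.
have -> : z.-1 = \sum_(1 <= x < z) 1 by rewrite sum_nat_const_nat muln1 subn1.
have -> : 2 * below P z = \sum_(1 <= x < z) (P x + P (z - x)).
  rewrite mul2n -addnn big_split; congr (_ + _); rewrite /below big_nat_rev.
  by apply: eq_big_nat => x xz; rewrite add1n subSS.
rewrite /corep /reps -!big_split; apply: eq_big_nat => x xz /=.
by case: (P x); case: (P (z - x)).
Qed.

Lemma schur_lower (P : pred nat) (N : nat) :
  'C(2 * below P N.+1 - N, 2) <= schur P N.+1.
Proof.
elim: N => [|N IH]; first by rewrite /below big_geq.
rewrite schurS belowS //; have := reps_corep P N.+1.
case: (P N.+1) => /= h; last first.
  by rewrite addn0 mul0n addn0; apply: leq_trans IH; apply: leq_bin2l; lia.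
apply: (@leq_trans 'C((2 * below P N.+1 - N).+1, 2)); first by apply: leq_bin2l; lia.
by rewrite binS bin1; lia.
Qed.

Lemma reps_le (P : pred nat) (z : nat) : reps P z <= below P z.
Proof. by apply: leq_sum => x _; case: (P x); case: (P _). Qed.

Lemma schur_upper (P : pred nat) (N : nat) :
  schur P N.+1 <= 'C(below P N.+1, 2).
Proof.
elim: N => [|N IH]; first by rewrite /schur big_geq.
rewrite schurS belowS //; have := reps_le P N.+1.
by case: (P N.+1); rewrite /= ?addn0 // addn1 binS bin1; lia.
Qed.

(** * Exact counts for intervals, with a hole or an isolated point *)

Lemma sum_pred1 (a z : nat) : \sum_(1 <= x < z) (x == a : nat) = (0 < a < z).
Proof.
elim: z => [|z IH]; first by rewrite big_geq // andbF.
case: z IH => [|z] IH; first by rewrite big_geq //; lia.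
by rewrite big_nat_recr //= IH; lia.
Qed.

Lemma sum_interval (a c z : nat) : 0 < a ->
  \sum_(1 <= x < z) (a <= x <= c : nat) = minn c.+1 z - a.
Proof.
move=> a0; elim: z => [|z IH]; first by rewrite big_geq //; lia.
case: z IH => [|z] IH; first by rewrite big_geq //; lia.
by rewrite big_nat_recr //= IH; lia.
Qed.

(** The full interval gives one pair for each x in [b, z - b]; the hole destroys (q, z - q) and its
    mirror, which coincide when z = 2q. *)
Lemma reps_punctured (b q z : nat) : 0 < b -> b <= q ->
  reps (fun x => (b <= x) && (x != q)) z + 2 * (q + b <= z) =
  z.+1 - 2 * b + (q + b <= z) * (z == 2 * q).
Proof.
move=> b0 bq.
transitivity (\sum_(1 <= x < z) ((b <= x <= z - b) +
    (q + b <= z) * (z == 2 * q) * (x == q))).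
  rewrite mul2n -addnn addnA.
  transitivity (\sum_(1 <= x < z) (
      (((b <= x) && (x != q)) && ((b <= z - x) && (z - x != q))) +
      (q + b <= z) * (x == q) + (q + b <= z) * (x == z - q))).
    by rewrite !big_split /= -!big_distrr /= !sum_pred1 /reps; congr (_ + _ + _);
      case: leqP => //; lia.
  by apply: eq_big_nat => x xz; lia.
by rewrite !big_split /= -!big_distrr /= sum_pred1 sum_interval //; nia.
Qed.

Lemma schur_interval (P : pred nat) (b K : nat) : 0 < b ->
  (forall x, 0 < x <= K -> P x = (b <= x)) ->
  schur P K.+1 = 'C(K + 2 - 2 * b, 2).
Proof.
move=> b0 PE.
(* A hole at [K + b] lies beyond the range, so the punctured formula also handles the full
   interval. *)
rewrite (eq_schur _ (fun x => (b <= x) && (x != K + b))); last by move=> x xK; rewrite PE; lia.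
have {PE P} : K < K + b by lia.
move: (K + b) (leq_addl K b) => q bq.
elim: K => [|K IH] Kq; first by rewrite /schur big_geq // bin_small; lia.
rewrite schurS IH; last lia.
have := reps_punctured b q K.+1 b0 bq.
have [hb|hb] := leqP (2 * b) (K + 2); last by rewrite !bin_small; nia.
have -> : K.+1 + 2 - 2 * b = (K + 2 - 2 * b).+1 by lia.
by rewrite binS bin1; lia.
Qed.

(** Relative to [b, K], the hole loses its own [q.+1 - 2 * b] representations and two for every
    element from q + b to K, except that 2q loses only one. *)
Lemma schur_punctured (b q K : nat) : 0 < b -> b <= q <= K ->
  schur (fun x => (b <= x) && (x != q)) K.+1 + (q.+1 - 2 * b) +
    2 * (K.+1 - b - q) = 'C(K + 2 - 2 * b, 2) + (2 * q <= K).
Proof.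
move=> b0 /andP[bq]; elim: K => [|K IH] qK; first lia.
rewrite schurS; have := reps_punctured b q K.+1 b0 bq.
have [qK'|Kq] := leqP q K.
  have := IH qK'.
  have [hb|hb] := leqP (2 * b) (K + 2); last by rewrite !bin_small; lia.
  have -> : K.+1 + 2 - 2 * b = (K + 2 - 2 * b).+1 by lia.
  by rewrite binS bin1; lia.
have {qK Kq} -> : q = K.+1 by lia.
rewrite (schur_interval _ b) //; last by move=> x; lia.
have [hb|hb] := leqP (2 * b) (K + 2); last by rewrite !bin_small; lia.
have -> : K.+1 + 2 - 2 * b = (K + 2 - 2 * b).+1 by lia.
by rewrite binS bin1; lia.
Qed.

Lemma reps_isolated (a c z : nat) : 0 < c -> 2 * c < a -> a <= z ->
  reps (fun x => (x == c) || (a <= x)) z = z.+1 - 2 * a + 2 * (a + c <= z).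
Proof.
move=> c0 ca az.
transitivity (\sum_(1 <= x < z) ((a <= x <= z - a) +
    (a + c <= z) * (x == c) + (a + c <= z) * (x == z - c))).
  by apply: eq_big_nat => x xz; lia.
by rewrite !big_split /= -!big_distrr /= !sum_pred1 sum_interval; nia.
Qed.

(** Besides the sums inside [a, K], each element from a + c on has two pairs using c; [2 * c < a]
    rules out c + c. *)
Lemma schur_isolated (a c K : nat) : 0 < c -> 2 * c < a ->
  schur (fun x => (x == c) || (a <= x)) K.+1 =
  'C(K + 2 - 2 * a, 2) + 2 * (K.+1 - a - c).
Proof.
move=> c0 ca; elim: K => [|K IH]; first by rewrite /schur big_geq // bin_small; lia.
rewrite schurS IH.
have -> : ((K.+1 == c) || (a <= K.+1)) * reps (fun x => (x == c) || (a <= x)) K.+1 =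
   (a <= K.+1) * (K.+2 - 2 * a + 2 * (a + c <= K.+1)).
  have [aK|Ka] := leqP a K.+1; first by rewrite reps_isolated // orbT.
  rewrite orbF; case: eqP => // ->; rewrite mul1n mul0n /reps big1_seq //.
  by move=> x /=; rewrite mem_index_iota; lia.
have [hb|hb] := leqP (2 * a) (K + 2); last by rewrite !bin_small; lia.
have -> : K.+1 + 2 - 2 * a = (K + 2 - 2 * a).+1 by lia.
by rewrite binS bin1; lia.
Qed.

Lemma interval_in_R (s : nat) : 'C(s, 2) \in R s s.
Proof.
apply/R_schurP; exists predT; split.
  by rewrite /below sum_nat_const_nat muln1 subn1.
rewrite (schur_interval _ 1) //; last by move=> x /=; lia.
by congr 'C(_, 2); lia.
Qed.

Lemma punctured_in_R (s b q n : nat) : 0 < b -> b <= q <= b + s ->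
  n + (q.+1 - 2 * b) + 2 * (s.+1 - q) = 'C(s + 2 - b, 2) + (2 * q <= b + s) ->
  n \in R s (b + s).
Proof.
move=> b0 bq En; apply/R_schurP; exists (fun x => (b <= x) && (x != q)); split.
  apply: (@addIn 1).
  have <- : \sum_(1 <= x < (b + s).+1) (x == q : nat) = 1 by rewrite sum_pred1; lia.
  rewrite /below -big_split /=.
  transitivity (\sum_(1 <= x < (b + s).+1) (b <= x <= b + s : nat)).
    by apply: eq_big_nat => x xs; lia.
  by rewrite sum_interval // sum_pred1; lia.
have := schur_punctured b q (b + s) b0 bq.
have -> : b + s + 2 - 2 * b = s + 2 - b by lia.
lia.
Qed.

Lemma isolated_in_R (s b c : nat) : 0 < s -> 0 < c -> 2 * c < b + 2 ->
  'C(s - b - 2, 2) + 2 * (s.-1 - c) \in R s (b + s).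
Proof.
move=> s0 c0 cb; apply/R_schurP.
exists (fun x => (x == c) || (b + 2 <= x)); split; last first.
  rewrite schur_isolated //.
  have -> : b + s + 2 - 2 * (b + 2) = s - b - 2 by lia.
  by lia.
transitivity (\sum_(1 <= x < (b + s).+1) ((b + 2 <= x <= b + s) + (x == c))).
  by apply: eq_big_nat => x xs; lia.
by rewrite big_split /= sum_interval ?sum_pred1 //; lia.
Qed.

(** * Attained values, block by block between triangular numbers *)

Lemma bin2_block (m n v : nat) : 'C(m, 2) <= v < 'C(n, 2) ->
  exists t o, [/\ m <= t < n, o < t & v = 'C(t, 2) + o].
Proof.
elim: n => [|n IH] /andP[mv vn]; first by rewrite ltn0 in vn.
have [h|h] := ltnP v 'C(n, 2).
  by have [|t [o [? ? ?]]] := IH; [rewrite mv|exists t, o; split=> //; lia].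
move: vn; rewrite binS bin1 => vn; exists n, (v - 'C(n, 2)); split; try lia.
rewrite ltnS leqnn andbT leqNgt; apply/negP => nm.
by have := leq_bin2l 2 nm; rewrite binS bin1; lia.
Qed.

Lemma R_attained (s N v : nat) : s <= N <= 2 * s - 1 ->
  'C(2 * s - N, 2) <= v <= 'C(s, 2) ->
  (forall i, 0 < i <= minn (s - uphalf N) ((N - s) %/ 2) ->
     v != 'C(2 * s - N, 2) + (2 * i - 1)) ->
  v \in R s N.
Proof.
move=> sN /andP[fv]; rewrite leq_eqVlt => /predU1P[-> _|vg nexc].
  by apply: R_mono (interval_in_R s); lia.
have [|t [o [ht ot vE]]] := bin2_block (2 * s - N) s v; first by rewrite fv.
pose b := s - t.
(* The set [b, b + s] with b + j deleted misses only odd offsets o < 2b - 1;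
   for o >= b use {b - (o - 1) / 2} U [b + 2, b + s], and for o < b the set
   [b + 1, b + s + 1] with one point deleted, which fits unless b = N - s. *)
have S2 m : 'C(m.+2, 2) = 'C(m, 2) + 2 * m + 1 by rewrite !binS !bin1 bin0; lia.
have S2t := S2 t.
have sb : s + 2 - b = t.+2 by lia.
suff [c [cb vR]] : exists c, c <= N - s /\ v \in R s (c + s).
  by apply: R_mono vR; lia.
have punct j : j <= s ->
    v + (j.+1 - b) + 2 * (t.+1 - j) = 'C(t.+2, 2) + (2 * j <= t) ->
    exists c, c <= N - s /\ v \in R s (c + s).
  move=> js E; exists b; split; first lia.
  by apply: (punctured_in_R s b (b + j)); rewrite ?sb; lia.
(* Here j >= b, and the count is solved by j = o + 2 - b, or by one less when 2q, for the hole q = b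
   + j, is still in the set. *)
have [ob|ob] := leqP (2 * b) o.+1.
  have [h|h] := leqP (2 * (o + 1 - b)) t; first by apply: (punct (o + 1 - b)); lia.
  by apply: (punct (o + 2 - b)); lia.
have [oe|oo] := boolP (2 %| o); first by apply: (punct (o %/ 2)); lia.
have [bo|bo] := leqP b o.
  exists b; split; first lia.
  have -> : v = 'C(s - b - 2, 2) + 2 * (s.-1 - (b - o %/ 2)).
    have -> : s - b - 2 = t - 2 by lia.
    have := S2 (t - 2); have -> : (t - 2).+2 = t by lia.
    by lia.
  by apply: isolated_in_R; lia.
have [bN|bN] := ltnP b (N - s).
  (* The full interval counts C(t, 2) + t; a hole this high is a summand of no element and loses
     only its own t - o representations. *)
  exists b.+1; split; first lia.
  apply: (punctured_in_R s b.+1 (b.+1 + (b + t - o))); try lia.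
  have -> : s + 2 - b.+1 = t.+1 by lia.
  by rewrite binS bin1; lia.
have tE : t = 2 * s - N by lia.
(* The surviving o = 2i - 1 is below both t and N - s, which is exactly the range of i in [nexc]. *)
have := nexc (o %/ 2).+1; rewrite -tE vE => /(_ _); lia.
Qed.

(** * The value just above the minimum is not attained *)

Lemma term_le_sum (F : nat -> nat) (x z : nat) :
  0 < x < z -> F x <= \sum_(1 <= y < z) F y.
Proof.
move=> xz; rewrite (big_cat_nat (n := x)) /=; try lia.
by rewrite (big_ltn (m := x)) /=; lia.
Qed.

Lemma reps_gt0P (P : pred nat) (z : nat) :
  reflect (exists x y, [/\ 0 < x, 0 < y, x + y = z, P x & P y]) (0 < reps P z).
Proof.
apply: (iffP idP) => [|[x [y [x0 y0 <- Px Py]]]]; last first.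
  apply: (@leq_trans (P x && P (x + y - x))); first by rewrite addKn Px Py.
  by apply: (term_le_sum (fun u => P u && P (x + y - u) : nat)); lia.
rewrite lt0n sum_nat_seq_neq0 => /hasP[x].
rewrite mem_index_iota /= => xz; rewrite eqb0 negbK => /andP[Px Pzx].
by exists x, (z - x); split=> //; lia.
Qed.

(** A pair and its mirror count separately, so one pair with distinct entries suffices. *)
Lemma reps_gt1 (P : pred nat) (x x' y y' z : nat) :
  0 < x -> 0 < x' -> x + x' = z -> 0 < y -> 0 < y' -> y + y' = z -> x != y ->
  P x -> P x' -> P y -> P y' -> 1 < reps P z.
Proof.
move=> x0 x0' xz y0 y0' yz xy Px Px' Py Py'.
apply: (@leq_trans (\sum_(1 <= u < z) ((u == x) + (u == y)))).
  by rewrite big_split /= !sum_pred1; lia.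
apply: leq_sum => u _; case: eqP => [->|_]; last first.
  by case: eqP => [->|//]; rewrite -yz addKn Py Py'.
by rewrite (negbTE xy) -xz addKn Px Px'.
Qed.

Lemma schur_eq0_sumfree (P : pred nat) (z x y : nat) : schur P z = 0 ->
  0 < x -> 0 < y -> x + y < z -> P x -> P y -> P (x + y) = false.
Proof.
move=> s0 x0 y0 xyz Px Py; apply/negP => Pxy.
suff : P (x + y) * reps P (x + y) <= schur P z.
  have : 0 < reps P (x + y) by apply/reps_gt0P; exists x, y.
  by rewrite s0 Pxy; lia.
by apply: (term_le_sum (fun y => P y * reps P y)); lia.
Qed.

Lemma corep_eq0 (P : pred nat) (x y z : nat) :
  corep P z = 0 -> 0 < x -> 0 < y -> x + y = z -> ~~ P x -> P y.
Proof.
move=> c0 x0 y0 xyz nx; apply/negPn/negP => ny.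
suff : 0 < corep P z by rewrite c0.
by apply/reps_gt0P; exists x, y.
Qed.

(** Here D = N - s and [M.+2] = 2s - N. Without the top element, [schur_lower] on the shorter range
    would exceed the minimum by [M.+2], more than the permitted 1. *)
Lemma near_min_peel (P : pred nat) (D M : nat) :
  below P (2 * D + M.+2).+1 = D + M.+2 ->
  schur P (2 * D + M.+2).+1 <= 'C(M.+2, 2) + 1 ->
  [/\ P (2 * D + M.+2), below P (2 * D + M.+2) = D + M.+1 &
      schur P (2 * D + M.+2).+1 =
      schur P (2 * D + M.+2) + M.+1 + corep P (2 * D + M.+2)].
Proof.
rewrite addnS belowS // schurS; have := reps_corep P (2 * D + M.+1).+1.
have := schur_lower P (2 * D + M.+1).
case: (P _) => /= lb E bE sE; last first.
  have : 'C(M.+3, 2) <= 'C(2 * below P (2 * D + M.+1).+1 - (2 * D + M.+1), 2).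
    by apply: leq_bin2l; lia.
  by rewrite (binS M.+2) bin1; lia.
by split; lia.
Qed.

(** Each peeling step takes from the count at least what it takes from the minimum, so the slack of
    1 passes down to 2D + 2. *)
Lemma near_min_tail (P : pred nat) (D M : nat) :
  below P (2 * D + M.+2).+1 = D + M.+2 ->
  schur P (2 * D + M.+2).+1 <= 'C(M.+2, 2) + 1 ->
  [/\ forall z, 2 * D + 2 <= z <= 2 * D + M.+2 -> P z,
      below P (2 * D + 2) = D + 1 &
      schur P (2 * D + 2) + corep P (2 * D + 2) <= 1].
Proof.
elim: M => [|M IH] bE sE; have [Pt bE' sE'] := near_min_peel P D _ bE sE.
  rewrite binn in sE.
  by split=> [z zD||]; [have -> : z = 2 * D + 2 by lia| lia | lia].
rewrite binS bin1 in sE.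
have E : 2 * D + M.+3 = (2 * D + M.+2).+1 by lia.
rewrite E in bE' sE' sE Pt.
have [|PT bT sT] := IH bE'; first by lia.
split=> // z zM; have [zM'|zM'] := leqP z (2 * D + M.+2); first by apply: PT; lia.
by have -> : z = (2 * D + M.+2).+1 by lia.
Qed.

(* Pairs summing to 2D and to 2D+2 propagate membership along the odd numbers
   below D, and then 2D-2 is a sum of two elements. *)
Lemma near_min_top_missing (P : pred nat) (D : nat) : 1 < D ->
  ~~ P (2 * D).+1 -> below P (2 * D).+1 = D + 1 ->
  1 < schur P (2 * D).+1 + corep P (2 * D + 2).
Proof.
move=> D1 nP bE; rewrite ltnNge; apply/negP => sE.
move: bE sE; rewrite belowS ?schurS; last lia.
have := reps_corep P (2 * D); have := schur_lower P (2 * D).-1.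
rewrite prednK; last lia.
case PD: (P (2 * D)) => /= lb E bE sE; last first.
  have : 'C(3, 2) <= 'C(2 * below P (2 * D) - (2 * D).-1, 2).
    by apply: leq_bin2l; lia.
  by rewrite (_ : 'C(3, 2) = 3) //; lia.
(* At 2D, [reps] is [corep] plus one, so a single representation of 2D already consumes the
   slack. *)
have [c0 c2 s0 r1] : [/\ corep P (2 * D) = 0, corep P (2 * D + 2) = 0,
    schur P (2 * D) = 0 & reps P (2 * D) = 1] by split; lia.
have sumfree := schur_eq0_sumfree P (2 * D) _ _ s0.
have PDD : P D.
  by apply/negPn/negP => nD; move: (nD); rewrite (corep_eq0 P D D _ c0) //; lia.
(* As 2D = D + D is the only representation, an odd j < D in P puts 2D - j outside, and then the sum
   2D + 2 puts j + 2 inside. *)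
have odds i : 2 * i < D -> P (2 * i).+1.
  elim: i => [|i IH] iD; first by apply: (corep_eq0 P _ _ _ c2 _ _ _ nP); lia.
  have Pj : P (2 * i).+1 by apply: IH; lia.
  apply: (corep_eq0 P (2 * D - (2 * i).+1) _ _ c2); try lia.
  apply/negP => Pj'; suff : 1 < reps P (2 * D) by rewrite r1.
  by apply: (reps_gt1 _ D D _ _ _ _ _ _ _ _ _ _ _ _ Pj Pj'); lia.
have P1 : P 1 by apply: (odds 0); lia.
have nP2 : P (1 + 1) = false by apply: sumfree => //; lia.
have P2 : P (2 * D - 2) by apply: (corep_eq0 P 2 _ _ c0); rewrite ?nP2 //; lia.
have [Dev|Dodd] := boolP (2 %| D).
  have P3 : P D.-1 by rewrite (_ : D.-1 = (2 * (D.-1 %/ 2)).+1); [apply: odds; lia | lia].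
  have := sumfree D.-1 D.-1; rewrite (_ : D.-1 + D.-1 = 2 * D - 2); last lia.
  by rewrite P2 => H; suff : true = false by []; apply: H => //; lia.
have P3 : P (D - 2).
  by rewrite (_ : D - 2 = (2 * ((D - 2) %/ 2)).+1); [apply: odds; lia | lia].
have := sumfree (D - 2) D; rewrite (_ : D - 2 + D = 2 * D - 2); last lia.
by rewrite P2 => H; suff : true = false by []; apply: H => //; lia.
Qed.

Lemma min_succ_not_attained (P : pred nat) (D M : nat) : 1 < D ->
  below P (2 * D + M.+2).+1 = D + M.+2 ->
  schur P (2 * D + M.+2).+1 <> 'C(M.+2, 2) + 1.
Proof.
move=> D1 bE sE.
have [|PT bT sT] := near_min_tail P D M bE; first by rewrite sE.
have E2 : 2 * D + 2 = (2 * D).+2 by lia.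
move: (bT) (sT); rewrite {1 2}E2 belowS // schurS.
case P1: (P (2 * D).+1) => /= bT1 sT1; last first.
  have := near_min_top_missing P D D1; rewrite P1.
  by move=> /(_ isT); rewrite E2 in sT1 *; lia.
have cr := reps_corep P (2 * D).+1.
(* At 2D + 1, [reps] equals [corep], and a pair of non-elements has distinct entries because its sum
   is odd, so it would count twice. *)
have c1 : corep P (2 * D).+1 = 0.
  apply/eqP; rewrite -leqn0 leqNgt; apply/negP => /reps_gt0P[x [y [x0 y0 xy nx ny]]].
  suff : 1 < corep P (2 * D).+1 by lia.
  by apply: (reps_gt1 _ _ _ _ _ _ _ _ xy _ _ _ _ nx ny ny nx); lia.
have r1 : reps P (2 * D).+1 = 0 by lia.
have compl x y : 0 < x -> 0 < y -> x + y = (2 * D).+1 -> P y = ~~ P x.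
  move=> x0 y0 xy; case Px: (P x) => /=; last first.
    by apply: (corep_eq0 P x y _ c1); rewrite ?Px.
  apply/negP => Py; suff : 0 < reps P (2 * D).+1 by rewrite r1.
  by apply/reps_gt0P; exists x, y.
have [PD1|nPD1] := boolP (P D.+1).
  (* If D + 1 + j is in, D - j is out, so D + 2 + j must be in because of the sum 2D + 2. Thus P is
     [D + 1, N], which attains the minimum itself. *)
  have up j : j < D -> P (D.+1 + j).
    elim: j => [|j IH] jD; first by rewrite addn0.
    apply/negPn/negP => nP; suff : 1 < corep P (2 * D + 2) by lia.
    have nj : ~~ P (D - j) by rewrite -(compl _ (D.+1 + j)); [apply: IH| | |]; lia.
    by apply: (reps_gt1 _ _ _ _ _ _ _ _ _ _ _ _ _ nj nP nP nj); lia.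
  have interval x : 0 < x <= 2 * D + M.+2 -> P x = (D.+1 <= x).
    move=> xN; have [xD|xD] := leqP x D.
      rewrite (compl (D.+1 + (D - x))); [|lia..].
      by rewrite up; lia.
    have [xD'|xD'] := leqP x (2 * D).
      by rewrite (_ : x = D.+1 + (x - D.+1)) ?up //; lia.
    have [h|h] := leqP (2 * D + 2) x; first by rewrite PT //; lia.
    by rewrite (_ : x = (2 * D).+1) ?P1; lia.
  move: sE; rewrite (schur_interval P D.+1) //.
  by rewrite (_ : 2 * D + M.+2 + 2 - 2 * D.+1 = M.+2); lia.
(* The pair (D + 1, D + 1) uses up the slack, so P is sum-free up to 2D; yet D is in, hence 2D out,
   1 in, and finally 2 = 1 + 1 in. *)
have c2 : 0 < corep P (2 * D + 2).
  by apply/reps_gt0P; exists D.+1, D.+1; split=> //; lia.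
have s1 : schur P (2 * D).+1 = 0 by lia.
have sumfree := schur_eq0_sumfree P _ _ _ s1.
have PD : P D by rewrite (compl D.+1) //; lia.
have nP2D : P (D + D) = false by apply: sumfree => //; lia.
have P11 : P 1 by rewrite (compl (D + D)) ?nP2D //; lia.
have P2 : P (1 + 1).
  apply/negPn/negP => nP2; suff : 1 < corep P (2 * D + 2) by lia.
  apply: (reps_gt1 _ (1 + 1) (D + D) D.+1 D.+1); rewrite /= ?nP2D //; lia.
by rewrite (sumfree 1 1) // in P2; lia.
Qed.

(** * Extreme values and the three ranges of N *)

Lemma R_bounds (s N v : nat) : v \in R s N -> 'C(2 * s - N, 2) <= v <= 'C(s, 2).
Proof. by move=> /R_schurP[P [<- <-]]; rewrite schur_lower schur_upper. Qed.

Lemma gmaxE (s N : nat) : s <= N -> gmax s N = 'C(s, 2).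
Proof.
move=> sN; apply/eqP; rewrite eqn_leq (gmax_ge (R_mono s s N _ sN (interval_in_R s))).
by case/andP: (R_bounds _ _ _ (gmax_in sN)) => _ ->.
Qed.

Lemma fminE (s N : nat) : 0 < s -> s <= N -> fmin s N = 'C(2 * s - N, 2).
Proof.
move=> s0 sN; apply/eqP; rewrite eqn_leq; apply/andP; split; last first.
  by case/andP: (R_bounds _ _ _ (fmin_in sN)).
(* From N = 2s - 1 on the bound is 0, so it is enough to attain it at K; the exceptions in
   [R_attained] all lie above it. *)
apply: fmin_le; set K := minn N (2 * s - 1).
have -> : 'C(2 * s - N, 2) = 'C(2 * s - K, 2).
  have [h|h] := leqP N (2 * s - 1); first by congr 'C(_, 2); lia.
  by rewrite !bin_small; lia.
apply: (R_mono s K); first by lia.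
apply: R_attained => [||i]; [lia| |lia].
by rewrite leqnn; apply: leq_bin2l; lia.
Qed.

(** [hK] leaves no exceptional i in [R_attained]: floor((K - s) / 2) or s - ceil(K / 2) vanishes. A
    range K shorter than N serves N above 2s - 1. *)
Lemma R_eq_itv (s N K : nat) : 0 < s -> s <= K <= N -> K <= 2 * s - 1 ->
  'C(2 * s - K, 2) = 'C(2 * s - N, 2) -> K <= s + 1 \/ 2 * s - 1 <= K ->
  R s N = itv (fmin s N) (gmax s N).
Proof.
move=> s0 sKN Ks EK hK; rewrite fminE ?gmaxE; try lia.
apply/fsetP => v; rewrite in_itv; apply/idP/idP => [/R_bounds //|vb].
apply: (R_mono s K); first lia.
by apply: R_attained; rewrite ?EK //; lia.
Qed.

(* All truncated subtractions below are exact under the stated hypotheses, and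
   every %/ 2 of a product of consecutive naturals is exact. *)
Theorem theorem5p9 (s N : nat) (hs : 3 <= s) (hN : s <= N) :
  [/\ (N = s \/ N = s + 1 ->
        [/\ R s N = itv (fmin s N) (gmax s N),
            itv (fmin s N) (gmax s N) =
              itv (((2 * s - N) * (2 * s - N - 1)) %/ 2) ((s * (s - 1)) %/ 2)
          & 0 < fmin s N]),
      (s + 2 <= N <= 2 * s - 2 ->
        [/\ fmin s N = ((2 * s - N) * (2 * s - N - 1)) %/ 2,
            0 < fmin s N,
            gmax s N = (s * (s - 1)) %/ 2
          & exists E : {fset nat},
              [/\ R s N = itv (fmin s N) (gmax s N) `\` E,
                  [fset fmin s N + 1] `<=` E
                & E `<=` [fset fmin s N + (2 * i - 1)
                         | i in itv 1 (minn (s - uphalf N) ((N - s) %/ 2))]]])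
    & (2 * s - 1 <= N ->
        R s N = itv (fmin s N) (gmax s N) /\
        itv (fmin s N) (gmax s N) = itv 0 ((s * (s - 1)) %/ 2))].
Proof.
have s0 : 0 < s by lia.
have binE n : (n * (n - 1)) %/ 2 = 'C(n, 2) by rewrite bin2 divn2 subn1.
have Fpos : N <= 2 * s - 2 -> 0 < 'C(2 * s - N, 2) by rewrite bin_gt0; lia.
rewrite !binE; split=> [hNs|hNs|hNs].
- have fE := fminE s N s0 hN; have gE := gmaxE s N hN; split.
  + by apply: (R_eq_itv s N N); lia.
  + by rewrite fE gE.
  + by rewrite fE; apply: Fpos; lia.
- have fE := fminE s N s0 hN; have gE := gmaxE s N hN.
  split; rewrite ?fE //; first by apply: Fpos; lia.
  (* E is taken to be everything missing from the interval, so the work lies in its two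
     inclusions. *)
  exists (itv 'C(2 * s - N, 2) (gmax s N) `\` R s N); split.
  + apply/fsetP => v; rewrite !in_fsetD in_itv gE.
    by case: (boolP (v \in R s N)) => [/R_bounds->|]; rewrite ?andbF ?andbT ?andNb.
  + rewrite fsub1set in_fsetD in_itv gE; apply/andP; split.
      apply/negP => /R_schurP[P [bE sE]].
      have D1 : 1 < N - s by lia.
      apply: (min_succ_not_attained P (N - s) (2 * s - N - 2) D1).
        by rewrite (_ : _ + _ = N); lia.
      by rewrite (_ : 2 * (N - s) + _ = N) ?sE; [congr ('C(_, 2) + 1)|]; lia.
    have : 'C((2 * s - N).+1, 2) <= 'C(s, 2) by apply: leq_bin2l; lia.
    by rewrite binS bin1; lia.
  + apply/fsubsetP => v; rewrite in_fsetD in_itv gE => /andP[vR vb].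
    apply/negPn/negP => vE; case/negP: vR; apply: R_attained => //; first lia.
    move=> i ib; apply/eqP => Ev; case/negP: vE; apply/imfsetP.
    by exists i; rewrite //= in_itv.
- have RE : R s N = itv (fmin s N) (gmax s N).
    apply: (R_eq_itv s N (2 * s - 1)); try lia.
    by rewrite !bin_small; lia.
  by split=> //; rewrite fminE ?gmaxE // bin_small //; lia.
Qed.
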